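(* Let $Q$ be a quiver. If the underlying graph of $Q$ is a tree (in particular, if it is a Dynkin graph $\mathbb{A}_m$ with $m\ge 1$, $\mathbb{D}_n$ with $n\ge 4$, $\mathbb{E}_6$, $\mathbb{E}_7$ or $\mathbb{E}_8$), then the lattice $\mathscr{C}(S_Q)$ of all congruences on the path semigroup $S_Q$ is distributive.
   Context: A quiver $Q=(Q_0,Q_1,s,t)$ consists of a set $Q_0$ of vertices, a set $Q_1$ of arrows, and source and target maps $s,t:Q_1\to Q_0$; it is not necessarily finite. Its underlying graph is obtained by forgetting the orientation of the arrows. Paths are finite and include the trivial path at each vertex (identified with the vertex). Paths are composed from left to right: $\alpha\beta$ is the concatenation if $t(\alpha)=s(\beta)$ and is $0$ otherwise. The path semigroup $S_Q$ is the semigroup with zero whose nonzero elements are all paths in $Q$, with this multiplication. A congruence on a semigroup $S$ is an equivalence relation $\rho$ such that $(x,y)\in\rho$ implies $(ax,ay)\in\rho$ and $(xa,ya)\in\rho$ for all $a\in S$. $\mathscr{C}(S_Q)$ is the set of all congruences on $S_Q$, which is a complete lattice under inclusion. A lattice $L$ is distributive if $(a\vee b)\wedge c=(a\wedge c)\vee(b\wedge c)$ for all $a,b,c\in L$. *)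

(* Defs.v *)
From HB Require Import structures.
From mathcomp Require Import all_boot all_order.
From mathcomp Require Import boolp classical_sets.

Set Implicit Arguments.
Unset Strict Implicit.
Unset Printing Implicit Defensive.

Import Order.Theory.
Local Open Scope classical_set_scope.

Record quiver := Quiver {
  vertex : Type;
  arrow : Type;
  source : arrow -> vertex;
  target : arrow -> vertex
}.

(* Vertices and arrows form arbitrary sets; the decidable equality and the
   choice operator are the classical ones. *)
HB.instance Definition _ (Q : quiver) := gen_eqMixin (vertex Q).
HB.instance Definition _ (Q : quiver) := gen_choiceMixin (vertex Q).
HB.instance Definition _ (Q : quiver) := gen_eqMixin (arrow Q).
HB.instance Definition _ (Q : quiver) := gen_choiceMixin (arrow Q).

Section PathSemigroup.
Variable Q : quiver.

Fixpoint is_path (x : vertex Q) (l : seq (arrow Q)) : bool :=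
  if l is a :: l' then (source a == x) && is_path (target a) l' else true.

Definition endpoint (x : vertex Q) (l : seq (arrow Q)) : vertex Q :=
  last x (map (@target Q) l).

(* A path is a start vertex with a list of consecutive arrows; [(x, [::])] is
   the trivial path at [x]. *)
Record qpath := QPath {
  qpath_val : vertex Q * seq (arrow Q);
  _ : is_path qpath_val.1 qpath_val.2
}.

HB.instance Definition _ := [isSub for qpath_val].
HB.instance Definition _ := [Choice of qpath by <:].

Definition psource (p : qpath) : vertex Q := (qpath_val p).1.
Definition parrows (p : qpath) : seq (arrow Q) := (qpath_val p).2.
Definition ptarget (p : qpath) : vertex Q := endpoint (psource p) (parrows p).

Lemma endpoint_cat x l1 l2 :
  endpoint x (l1 ++ l2) = endpoint (endpoint x l1) l2.
Proof. by rewrite /endpoint map_cat last_cat. Qed.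

Lemma is_path_cat x l1 l2 :
  is_path x (l1 ++ l2) = is_path x l1 && is_path (endpoint x l1) l2.
Proof. by elim: l1 x => [|a l1 IH] x //=; rewrite IH andbA. Qed.

Lemma qcat_subproof (p q : qpath) :
  ptarget p = psource q -> is_path (psource p) (parrows p ++ parrows q).
Proof.
move=> pq; rewrite is_path_cat; apply/andP; split; first exact: (valP p).
by rewrite -[endpoint _ _]/(ptarget p) pq; exact: (valP q).
Qed.

Definition qcat (p q : qpath) (pq : ptarget p = psource q) : qpath :=
  @QPath (psource p, parrows p ++ parrows q) (qcat_subproof pq).

(* [None] is the zero element. *)
Definition path_semigroup : Type := option qpath.

HB.instance Definition _ := Choice.on path_semigroup.

Definition path_mul (u v : path_semigroup) : path_semigroup :=
  match u, v with
  | Some p, Some q =>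
      if ptarget p =P psource q is ReflectT pq then Some (qcat pq) else None
  | _, _ => None
  end.

Lemma path_mulA : associative path_mul.
Proof.
case=> [p|] [q|] [r|] //=; last by case: eqP.
case: (ptarget q =P psource r) => [qr|nqr];
  case: (ptarget p =P psource q) => [pq|npq] //=.
- have pqr : ptarget (qcat pq) = psource r.
    by rewrite -qr /ptarget endpoint_cat -pq.
  case: (ptarget (qcat pq) =P _) => [e1|//].
  by congr Some; apply: val_inj; rewrite /= catA.
- case: eqP => // e1; case: nqr; rewrite -e1 [RHS]/ptarget endpoint_cat.
  by rewrite -[endpoint _ (parrows p)]/(ptarget p) pq.
Qed.

HB.instance Definition _ := isSemigroup.Build path_semigroup path_mulA.

End PathSemigroup.

Section Congruence.
Variable S : semigroupType.

Definition is_congruence (r : set (S * S)) : Prop :=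
  [/\ forall x, r (x, x),
      forall x y, r (x, y) -> r (y, x),
      forall x y z, r (x, y) -> r (y, z) -> r (x, z) &
      forall x y, r (x, y) ->
        forall a, r ((a * x)%g, (a * y)%g) /\ r ((x * a)%g, (y * a)%g)].

Record congruence := Congruence {
  cong_rel :> set (S * S);
  _ : `[< is_congruence cong_rel >]
}.

HB.instance Definition _ := [isSub for cong_rel].
HB.instance Definition _ := [Choice of congruence by <:].

Lemma congruenceP (r : congruence) : is_congruence r.
Proof. exact/asboolP/(valP r). Qed.

Definition cong_le (r s : congruence) : bool := `[< r `<=` s >].

Lemma cong_le_refl : reflexive cong_le.
Proof. by move=> r; apply/asboolP. Qed.

Lemma cong_le_anti : antisymmetric cong_le.
Proof.
by move=> r s /andP[/asboolP rs /asboolP sr]; apply: val_inj; apply/seteqP.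
Qed.

Lemma cong_le_trans : transitive cong_le.
Proof.
by move=> s r t /asboolP rs /asboolP st; apply/asboolP; apply: subset_trans st.
Qed.

Lemma cong_meet_subproof (r s : congruence) : `[< is_congruence (r `&` s) >].
Proof.
apply/asboolP; case: (congruenceP r) => r1 r2 r3 r4.
case: (congruenceP s) => s1 s2 s3 s4; split.
- by move=> x; split.
- by move=> x y [/r2 ? /s2 ?]; split.
- by move=> x y z [rxy sxy] [ryz syz]; split; [exact: r3 ryz|exact: s3 syz].
- by move=> x y [/r4 rxy /s4 sxy] a; case: (rxy a); case: (sxy a).
Qed.

Definition cong_meet (r s : congruence) : congruence :=
  Congruence (cong_meet_subproof r s).

Definition cong_join_rel (r s : congruence) : set (S * S) :=
  \bigcap_(c in [set c : congruence | r `|` s `<=` c]) c.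

Lemma cong_join_subproof (r s : congruence) :
  `[< is_congruence (cong_join_rel r s) >].
Proof.
apply/asboolP; split.
- by move=> x c _; case: (congruenceP c).
- by move=> x y xy c /[dup] /xy cxy _; case: (congruenceP c) => _ + _ _; apply.
- move=> x y z xy yz c cc; case: (congruenceP c) => _ _ + _.
  by apply; [exact: xy|exact: yz].
- move=> x y xy a; split=> c /xy cxy;
  by case: (congruenceP c) => _ _ _ /(_ _ _ cxy a)[].
Qed.

Definition cong_join (r s : congruence) : congruence :=
  Congruence (cong_join_subproof r s).

Lemma cong_meetP (r s t : congruence) :
  cong_le r (cong_meet s t) = cong_le r s && cong_le r t.
Proof. by rewrite /cong_le -asbool_and -subsetI. Qed.

Lemma cong_joinP (r s t : congruence) :
  cong_le (cong_join r s) t = cong_le r t && cong_le s t.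
Proof.
rewrite /cong_le -asbool_and; apply: asbool_equiv_eq; split=> [rst|[rt st]].
  by split=> u ru; apply: rst => c; apply; [left|right].
by move=> u; apply; rewrite /= subUset.
Qed.

End Congruence.

Fact congruence_display : Order.disp_t. Proof. exact: (Order.Disp tt tt). Qed.

HB.instance Definition _ (S : semigroupType) :=
  Order.Le_isPOrder.Build congruence_display (congruence S)
    (@cong_le_refl S) (@cong_le_anti S) (@cong_le_trans S).

HB.instance Definition _ (S : semigroupType) :=
  Order.POrder_MeetJoin_isLattice.Build congruence_display (congruence S)
    (@cong_meetP S) (@cong_joinP S).

Definition lattice_distributive (d : Order.disp_t) (L : latticeType d) : Prop :=
  forall a b c : L, ((a `|` b) `&` c = (a `&` c) `|` (b `&` c))%O.

(* Undirected graphs, with loops and multiple edges allowed: an edge has an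
   unordered pair of (possibly equal) ends. *)
Record graph := Graph {
  gvertex : Type;
  gedge : Type;
  ends : gedge -> set gvertex;
  _ : forall e, exists x y, ends e = [set x; y]
}.

HB.instance Definition _ (G : graph) := gen_eqMixin (gvertex G).
HB.instance Definition _ (G : graph) := gen_eqMixin (gedge G).

Lemma underlying_subproof (Q : quiver) (a : arrow Q) :
  exists x y, [set source a; target a] = [set x; y].
Proof. by exists (source a), (target a). Qed.

Definition underlying_graph (Q : quiver) : graph :=
  Graph (@underlying_subproof Q).

Section Tree.
Variable G : graph.

(* [w] lists the edges of a walk from [x], each with the vertex it leads to. *)
Fixpoint walk (x : gvertex G) (w : seq (gedge G * gvertex G)) : Prop :=
  if w is (e, y) :: w' then ends e = [set x; y] /\ walk y w' else True.

Definition walk_end (x : gvertex G) (w : seq (gedge G * gvertex G)) :=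
  last x (unzip2 w).

Definition connected_graph : Prop :=
  (exists x : gvertex G, True) /\
  forall x y, exists2 w, walk x w & walk_end x w = y.

(* A loop is a cycle of length 1; two parallel edges form a cycle of
   length 2. *)
Definition graph_cycle (x : gvertex G) (w : seq (gedge G * gvertex G)) : Prop :=
  [/\ w <> [::], walk x w, walk_end x w = x, uniq (unzip1 w) & uniq (unzip2 w)].

Definition is_tree : Prop :=
  connected_graph /\ forall x w, ~ graph_cycle x w.

End Tree.

Definition graph_iso (G H : graph) : Prop :=
  exists (f : gvertex G -> gvertex H) (g : gedge G -> gedge H),
    [/\ bijective f, bijective g & forall e, ends (g e) = f @` ends e].

Lemma parent_graph_subproof (m : nat) (p : nat -> nat) (i : 'I_m) :
  exists x y : 'I_m.+1, [set lift ord0 i; inord (p i)] = [set x; y].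
Proof. by exists (lift ord0 i), (inord (p i)). Qed.

(* Vertices 0, ..., m and, for each i < m, one edge between i + 1 and p i;
   [p i <= m] is assumed, as [inord] is meaningless otherwise. *)
Definition parent_graph (m : nat) (p : nat -> nat) : graph :=
  Graph (@parent_graph_subproof m p).

Definition graph_A (m : nat) : graph := parent_graph m.-1 id.

(* The path 0 - 1 - ... - (n - 2), with the vertex n - 1 attached to n - 3. *)
Definition graph_D (n : nat) : graph :=
  parent_graph n.-1 (fun i => if i.+2 == n then n - 3 else i).

(* The path 0 - 1 - ... - (n - 2), with the vertex n - 1 attached to 2. *)
Definition graph_E (n : nat) : graph :=
  parent_graph n.-1 (fun i => if i.+2 == n then 2 else i).

Definition is_dynkin (G : graph) : Prop :=
  [\/ exists2 m, 1 <= m & graph_iso G (graph_A m),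
      exists2 n, 4 <= n & graph_iso G (graph_D n) |
      exists2 n, n \in [:: 6; 7; 8] & graph_iso G (graph_E n)].

(* Main.v *)
Require Import Defs.
From mathcomp Require Import all_boot all_order.
From mathcomp Require Import boolp classical_sets.

(* In an acyclic graph a walk without backtracking never revisits a vertex.
   Following one of two parallel paths backwards and then the other forwards, from
   the point where they diverge, gives a closed walk without backtracking, so if
   the underlying graph is a tree then parallel paths are equal.  Hence if
   [p] and [q] are distinct paths related by a congruence, multiplying by the
   trivial paths at the ends of [p] fixes [p] and kills [q], so that [p] is
   related to [0].  A congruence is thus determined by the ideal of the elements
   related to [0], and joins and meets are unions and intersections of ideals. *)

Set Implicit Arguments.
Unset Strict Implicit.
Unset Printing Implicit Defensive.

Import Order.Theory.
Local Open Scope classical_set_scope.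

(** * Semigroups with zero whose congruences are determined by ideals *)

Section ReesDistributive.
Variables (S : semigroupType) (z : S).
Hypothesis mulz : forall a : S, (z * a)%g = z.
Hypothesis zmul : forall a : S, (a * z)%g = z.
Hypothesis sep : forall x y : S, x <> z -> x <> y ->
  exists a b : S, (a * x * b)%g = x /\ (a * y * b)%g = z.

Lemma cong_sym (r : congruence S) x y : cong_rel r (x, y) -> cong_rel r (y, x).
Proof. by case: (congruenceP r) => _ + _ _; apply. Qed.

Lemma cong_trans (r : congruence S) x y t :
  cong_rel r (x, y) -> cong_rel r (y, t) -> cong_rel r (x, t).
Proof. by case: (congruenceP r) => _ _ + _; apply. Qed.

Definition zero_class (r : congruence S) : set S := [set x | cong_rel r (x, z)].

(** Multiplying the pair by the elements [a] and [b] of [sep] turns it into [(x, z)]. *)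
Lemma cong_zero (r : congruence S) x y :
  cong_rel r (x, y) -> x <> y -> zero_class r x.
Proof.
case: (congruenceP r) => r1 _ _ r4 rxy xy.
have [->|xz] := pselect (x = z); first exact: r1.
have [a [b [ax ay]]] := sep xz xy.
have [/r4 /(_ b)[_ +] _] := r4 _ _ rxy a.
by rewrite ax ay.
Qed.

Lemma zero_classM (r : congruence S) x s :
  zero_class r x -> zero_class r (s * x)%g /\ zero_class r (x * s)%g.
Proof.
case: (congruenceP r) => _ _ _ r4 /r4/(_ s).
by rewrite /zero_class /= mulz zmul.
Qed.

(** The Rees congruence of the ideal formed by the union of the two zero classes. *)
Definition rees_join (a b : congruence S) : set (S * S) :=
  [set u | u.1 = u.2 \/ (zero_class a `|` zero_class b) u.1 /\
                        (zero_class a `|` zero_class b) u.2].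

Lemma rees_join_subproof (a b : congruence S) :
  `[< is_congruence (rees_join a b) >].
Proof.
apply/asboolP.
have ideal x s : (zero_class a `|` zero_class b) x ->
    (zero_class a `|` zero_class b) (s * x)%g /\
    (zero_class a `|` zero_class b) (x * s)%g.
  by case=> /(@zero_classM _ _ s)[? ?]; split; [left|left|right|right].
split.
- by move=> x; left.
- by move=> x y [/= ->|[xz yz]]; [left|right].
- by move=> x y t [/= ->//|[/= xz yz]] [/= <-|[/= _ tz]]; right.
- move=> x y [/= ->|[/= xz yz]] s; first by split; left.
  have [? ?] := ideal x s xz; have [? ?] := ideal y s yz.
  by split; right.
Qed.

(** The join is the least congruence above [a] and [b], and both lie in [rees_join a b] by
    [cong_zero], applied to a nontrivial pair and to its reverse. *)
Lemma cong_join_rees (a b : congruence S) :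
  cong_rel (a `|` b)%O `<=` rees_join a b.
Proof.
suff : cong_le (cong_join a b) (Congruence (rees_join_subproof a b)).
  by move/asboolP.
rewrite cong_joinP; apply/andP; split; apply/asboolP => -[x y] xy /=;
  have [->|nxy] := pselect (x = y); try (by left); right => /=; split.
- by left; exact: cong_zero xy nxy.
- by left; apply: cong_zero (cong_sym xy) _ => /esym.
- by right; exact: cong_zero xy nxy.
- by right; apply: cong_zero (cong_sym xy) _ => /esym.
Qed.

(** One inequality holds in every lattice. For the other, each member of a nontrivial pair lies in
    the zero class of [c] and in that of [a] or [b]; the pair is then linked through [z]. *)
Lemma rees_lattice_distributive : lattice_distributive (congruence S).
Proof.
move=> a b c; apply/le_anti/andP; split; last first.
  by rewrite leUx !lexI !leIr !andbT !leIxl ?leUl ?leUr.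
apply/asboolP => -[x y] [/cong_join_rees /= abxy cxy].
have [->|nxy] := pselect (x = y).
  by case: (congruenceP ((a `&` c) `|` (b `&` c))%O) => + _ _ _; apply.
case: abxy => [//|/= [xz yz]].
have join x' : (zero_class a `|` zero_class b) x' -> zero_class c x' ->
    zero_class ((a `&` c) `|` (b `&` c))%O x'.
  case=> x'z cz.
    have : (a `&` c <= (a `&` c) `|` (b `&` c))%O by exact: leUl.
    by move/asboolP; apply; split.
  have : (b `&` c <= (a `&` c) `|` (b `&` c))%O by exact: leUr.
  by move/asboolP; apply; split.
rewrite -[X in X (x, y)]/(cong_rel ((a `&` c) `|` (b `&` c))%O).
apply: (@cong_trans _ _ z); first exact: join xz (cong_zero cxy nxy).
by apply/cong_sym/(join _ yz)/(cong_zero (cong_sym cxy)) => /esym.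
Qed.

End ReesDistributive.

(** * Walks without backtracking in acyclic graphs *)

Section Walks.
Variable G : graph.
Implicit Types (x y v : gvertex G) (w : seq (gedge G * gvertex G)).

(** In a graph without loops, using an edge twice in a row is the same as backtracking. *)
Definition reduced w := sorted (fun e e' => e != e') (unzip1 w).

Lemma walk_cat x w1 w2 :
  walk x (w1 ++ w2) <-> walk x w1 /\ walk (walk_end x w1) w2.
Proof.
elim: w1 x => [|[e y] w1 IH] x; first by split=> [|[]].
rewrite /= IH; split=> [[? []]|[[? ?] ?]] //.
Qed.

Lemma walk_end_cat x w1 w2 :
  walk_end x (w1 ++ w2) = walk_end (walk_end x w1) w2.
Proof. by rewrite /walk_end /unzip2 map_cat last_cat. Qed.

Lemma walk_rev x w : walk x w ->
  exists2 w', walk (walk_end x w) w' & walk_end (walk_end x w) w' = x.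
Proof.
elim: w x => [|[e y] w IH] x; first by exists [::].
move=> [exy /IH[w' ww' end_w']].
exists (w' ++ [:: (e, x)]); last by rewrite walk_end_cat.
apply/walk_cat; split; first exact: ww'.
by rewrite [walk_end _ w']end_w' /= exy setUC.
Qed.

Lemma mem_ends_walk x w e v :
  walk x w -> e \in unzip1 w -> ends e v -> v \in x :: unzip2 w.
Proof.
elim: w x => [|[e' y] w IH] x //= [exy wy].
rewrite inE => /orP[/eqP->|/IH h].
  by rewrite exy => -[] ->; rewrite !inE eqxx ?orbT.
by move/(h _ wy) => vw; rewrite inE vw orbT.
Qed.

(** A second use of the first edge would revisit its end [x]. *)
Lemma uniq_walk_edges x w :
  walk x w -> uniq (x :: unzip2 w) -> uniq (unzip1 w).
Proof.
elim: w x => [|[e y] w IH] x //= [exy wy] /andP[xw uw].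
rewrite (IH _ wy uw) andbT; apply: contra xw => ew.
by apply: mem_ends_walk wy ew _; rewrite exy; left.
Qed.

Hypothesis acyclic : forall x w, ~ graph_cycle x w.

(** By induction only a return to [x] could repeat a vertex, and the part of the walk up to that
    return would be a cycle. *)
Lemma reduced_walk_uniq x w : walk x w -> reduced w -> uniq (x :: unzip2 w).
Proof.
elim: w x => [|[e y] w IH] x //= [exy wy] rw.
have uw : uniq (y :: unzip2 w) by apply: IH wy (path_sorted rw).
apply/andP; split=> //; apply/negP => xw.
have [w1 [w2 [defw end_w1]]] : exists w1 w2, w = w1 ++ w2 /\ walk_end y w1 = x.
  move: xw; rewrite inE => /orP[/eqP->|]; first by exists [::], w.
  move=> /mapP[[e' x'] ew /= ->]; case/path.splitPr: ew => w1 w2.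
  exists (rcons w1 (e', x')), w2; rewrite cat_rcons; split=> //.
  by rewrite /walk_end /unzip2 map_rcons last_rcons.
move: wy rw uw; rewrite {}defw => /walk_cat[wy _] rw.
rewrite /unzip2 map_cat -cat_cons cat_uniq => /andP[uw _].
apply: (@acyclic x ((e, y) :: w1)); split=> //.
rewrite /= (uniq_walk_edges wy uw) andbT.
(* It remains to see that [e] does not recur: it differs from the next edge since the walk is
   reduced, and any later use would revisit its end [y]. *)
move: rw wy uw; case: w1 {end_w1} => [|[e1 t] w1] //= /andP[ee1 _] [_ wt].
move=> /andP[yw1 _]; rewrite inE (negPf ee1) /=.
apply: contra yw1 => ew1; apply: mem_ends_walk wt ew1 _.
by rewrite exy; right.
Qed.

Lemma reduced_closed_walk x w :
  walk x w -> reduced w -> walk_end x w = x -> w = [::].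
Proof.
case: w => [//|[e y] w] ww rw end_w.
have /= /andP[/negP[]] := reduced_walk_uniq ww rw.
by rewrite -[X in X \in _]end_w; exact: (mem_last y (unzip2 w)).
Qed.

End Walks.

(** * Parallel paths in a quiver with acyclic underlying graph *)

Section TreePaths.
Variable Q : quiver.
Let G := underlying_graph Q.
Hypothesis acyclic : forall (x : gvertex G) w, ~ graph_cycle x w.

Lemma no_loop (a : arrow Q) : source a <> target a.
Proof.
by move=> st; apply: (@acyclic (source a) [:: (a, target a)]); split.
Qed.

Definition directed_walk (l : seq (arrow Q)) : seq (gedge G * gvertex G) :=
  [seq (a, target a) | a <- l].

(** The walk is reduced because an arrow that can follow itself is a loop. *)
Lemma directed_walkP (x : vertex Q) l : is_path x l ->
  [/\ walk (x : gvertex G) (directed_walk l), reduced (directed_walk l) &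
      walk_end (x : gvertex G) (directed_walk l) = endpoint x l].
Proof.
elim: l x => [|a l IH] x //= /andP[/eqP <- /[dup] pl /IH[wl rl el]].
split=> //; case: l pl rl {IH wl el} => [|b l] //= /andP[/eqP sb _] rl.
apply/andP; split=> //.
by apply/eqP => /= ab; apply: (@no_loop b); rewrite sb ab.
Qed.

(** The walk [w'] is the reversal of [l] followed by [w], built by moving the arrows of [l] one at a
    time to the front of [w]. The condition on first edges prevents backtracking at the junction;
    the size serves to show that [w'] is nonempty. *)
Lemma rev_directed_walk (x : vertex Q) l (w : seq (gedge G * gvertex G)) :
    is_path x l -> walk (x : gvertex G) w -> reduced w ->
    (if l is a :: _ then ohead (unzip1 w) <> Some (a : gedge G) else True) ->
  exists w', [/\ walk (endpoint x l : gvertex G) w', reduced w',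
    walk_end (endpoint x l : gvertex G) w' = walk_end (x : gvertex G) w &
    size w' = size l + size w].
Proof.
elim: l x w => [|a l IH] x w; first by exists w.
move=> /= /andP[/eqP sx pl] ww rw aw.
have [|||w' [ww' rw' ew' sw']] := IH (target a) ((a, x) :: w) pl.
- by split=> //=; rewrite setUC sx.
- case: w rw aw {ww} => [|[e y] w] //= rw aw; apply/andP; split=> //.
  by apply/eqP => /= ae; apply: aw; rewrite ae.
- case: l pl {IH} => [|b l] //= /andP[/eqP sb _] [ab].
  by apply: (@no_loop b); rewrite sb ab.
by exists w'; split=> //; rewrite sw' /= addnS.
Qed.

Lemma parallel_paths_eq (x : vertex Q) l1 l2 :
  is_path x l1 -> is_path x l2 -> endpoint x l1 = endpoint x l2 -> l1 = l2.
Proof.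
have nil_closed (y : vertex Q) l : is_path y l -> endpoint y l = y -> l = [::].
  move=> /directed_walkP[wl rl el] end_l.
  have := reduced_closed_walk acyclic wl rl (etrans el end_l).
  by case: l {wl rl el end_l}.
elim: l1 x l2 => [|a l1 IH] x [|b l2] // p1 p2 e12.
- by have := nil_closed _ _ p2 (esym e12).
- by have := nil_closed _ _ p1 e12.
have [ab|ab] := pselect (a = b).
  move: p1 p2 e12; rewrite ab /= => /andP[_ p1] /andP[_ p2] e12.
  by rewrite (IH _ _ p1 p2 e12).
have [w2 r2 e2] := directed_walkP p2.
have [|w [ww rw ew]] := rev_directed_walk p1 w2 r2; first by move=> [/esym].
(* The closed reduced walk [w] would be empty, but its size counts the arrows of both paths. *)
by rewrite (reduced_closed_walk acyclic ww rw) // ew e2 e12.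
Qed.

Lemma tree_congruence_distributive :
  lattice_distributive (congruence (path_semigroup Q)).
Proof.
pose idp (v : vertex Q) : qpath Q := @QPath Q (v, [::]) isT.
apply: (@rees_lattice_distributive _ (None : path_semigroup Q)).
- by [].
- by case.
case=> [p|] // y _ py.
have mull q : path_mul (Some (idp (psource p))) (Some q) =
    if psource p == psource q then Some q else None.
  rewrite /path_mul; case: (_ =P psource q) => [e|e];
    case: (psource p =P psource q) => // _.
  congr Some; apply: val_inj; case: (q) e => [[v l] /= i] e.
  by congr (_, _).
have mulr q : path_mul (Some q) (Some (idp (ptarget p))) =
    if ptarget q == ptarget p then Some q else None.
  rewrite /path_mul; case: (ptarget q =P _) => [e|e];
    case: (ptarget q =P ptarget p) => // _.
  by congr Some; apply: val_inj; rewrite /= cats0; case: (q) => [[]].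
exists (Some (idp (psource p))), (Some (idp (ptarget p))); split.
  by rewrite -[LHS]/(path_mul (path_mul _ _) _) mull eqxx mulr eqxx.
(* A path [q] that is not killed is parallel to [p], hence equal to it, contradicting [pq]. *)
case: y py => [q|] // pq.
rewrite -[LHS]/(path_mul (path_mul _ (Some q)) _) mull.
case: (psource p =P _) => // e; rewrite mulr.
case: (ptarget q =P _) => // e'; case: pq.
congr Some; apply: val_inj.
case: p q e e' {mull mulr} => [[u l] /= pl] [[v m] /= pm].
rewrite /ptarget /psource /parrows /= => uv; rewrite -uv in pm *.
by move=> /esym /(parallel_paths_eq pl pm) ->.
Qed.

End TreePaths.

(** * Invariance of trees under isomorphism *)

Section GraphIso.

Lemma graph_iso_sym (G H : graph) : graph_iso G H -> graph_iso H G.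
Proof.
move=> [f [g [[f' fK f'K] [g' gK g'K] fg]]]; exists f', g'; split.
- by exists f.
- by exists g.
move=> e; rewrite -[in RHS](g'K e) fg image_comp.
by rewrite (_ : f' \o f = id) ?image_id //; apply/funext => v /=; exact: fK.
Qed.

Variables (G H : graph) (f : gvertex G -> gvertex H) (g : gedge G -> gedge H).
Hypothesis fg : forall e, ends (g e) = f @` ends e.

Let map_walk (w : seq (gedge G * gvertex G)) := [seq (g u.1, f u.2) | u <- w].

Lemma walk_map x w : walk x w -> walk (f x) (map_walk w).
Proof.
elim: w x => [|[e y] w IH] x //= [exy /IH wy]; split=> //.
by rewrite fg exy image_setU !image_set1.
Qed.

Lemma walk_end_map x w : walk_end (f x) (map_walk w) = f (walk_end x w).
Proof. by elim: w x => [|[e y] w IH] x //=; apply: IH. Qed.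

Lemma cycle_map x w : injective f -> injective g ->
  graph_cycle x w -> graph_cycle (f x) (map_walk w).
Proof.
move=> fI gI [w0 ww end_w u1 u2]; split.
- by case: w w0 {ww end_w u1 u2}.
- exact: walk_map.
- by rewrite walk_end_map end_w.
- by rewrite /unzip1 -map_comp (map_comp g fst) map_inj_uniq.
- by rewrite /unzip2 -map_comp (map_comp f snd) map_inj_uniq.
Qed.

End GraphIso.

(** Cycles are carried from [G] to [H], and connecting walks from [H] back to [G]. *)
Lemma graph_iso_tree (G H : graph) : graph_iso G H -> is_tree H -> is_tree G.
Proof.
move=> GH [[[v _] Hc] Ha].
have [f [g [fb gb fg]]] := GH.
have [f' [g' [[h f'K hK] _ fg']]] := graph_iso_sym GH.
split; last by move=> x w /(cycle_map fg (bij_inj fb) (bij_inj gb))/Ha.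
split; first by exists (f' v).
move=> x y; have [w ww end_w] := Hc (h x) (h y).
exists [seq (g' u.1, f' u.2) | u <- w].
  by rewrite -[x]hK; exact: (walk_map fg' ww).
by have := walk_end_map f' g' (h x) w; rewrite end_w !hK.
Qed.

(** * Parent graphs and Dynkin graphs *)

Section ParentGraph.
Variables (m : nat) (p : nat -> nat).
Hypothesis ple : forall i, i < m -> p i <= i.
Let G := parent_graph m p.
Let vval (v : gvertex G) : nat := nat_of_ord (v : 'I_m.+1).
Let eval (e : gedge G) : nat := nat_of_ord (e : 'I_m).

Lemma vval_inj : injective vval.
Proof. by move=> x y xy; apply: ord_inj. Qed.

(** An unordered pair fixes its members up to order once its two ends are known to differ, which
    follows from [ple]. *)
Lemma parent_ends (e : gedge G) x y : ends e = [set x; y] ->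
  vval x = (eval e).+1 /\ vval y = p (eval e) \/
  vval x = p (eval e) /\ vval y = (eval e).+1.
Proof.
move=> exy.
have em : eval e < m := ltn_ord e.
have lt_p : p (eval e) < m.+1 by rewrite ltnS (leq_trans (ple em)) // ltnW.
have vl : vval (lift ord0 (e : 'I_m)) = (eval e).+1 by [].
have vp : vval (inord (p (eval e))) = p (eval e) by rewrite /vval inordK.
have : [set x; y] (lift ord0 (e : 'I_m) : gvertex G) by rewrite -exy; left.
have : [set x; y] (inord (p (eval e)) : gvertex G) by rewrite -exy; right.
have neq : vval (inord (p (eval e))) <> vval (lift ord0 (e : 'I_m)).
  by rewrite vp vl => pe; have := ple em; rewrite pe ltnn.
by case=> px; case=> lx; rewrite -?px -?lx; auto;
  case: neq; rewrite px lx.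
Qed.

(* Among the edges of index at most [k], only the edge [k] contains the vertex
   [k.+1], so a walk along such edges crosses between [k.+1] and the other
   vertices exactly when it uses the edge [k]. *)
Lemma parent_walk_parity k x (w : seq (gedge G * gvertex G)) :
  walk x w -> all (leq^~ k) (map eval (unzip1 w)) ->
  (vval x == k.+1) (+) (vval (walk_end x w) == k.+1)
    = odd (count_mem k (map eval (unzip1 w))).
Proof.
elim: w x => [|[e y] w IH] x /=; first by rewrite addbb.
move=> [exy wy] /andP[ek wk].
rewrite oddD -(IH _ wy wk) oddb addbA; congr (_ (+) _).
rewrite -[LHS](addbK (vval y == k.+1)); congr (_ (+) _).
have pk : (p (eval e) == k.+1) = false.
  by apply/negbTE; rewrite neq_ltn ltnS (leq_trans (ple (ltn_ord e)) ek).
by have [[-> ->]|[-> ->]] := parent_ends exy; rewrite pk eqSS ?addbF ?addFb.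
Qed.

Lemma parent_graph_tree : is_tree G.
Proof.
split; last first.
  move=> x w [w0 ww end_w uw _].
  (* Let [k] be the largest edge index in the cycle: by parity a closed walk uses the edge [k]
     evenly often, while a cycle uses it exactly once. *)
  have [k kw wk] : exists2 k, k \in map eval (unzip1 w)
      & all (leq^~ k) (map eval (unzip1 w)).
    have : map eval (unzip1 w) != [::] by case: (w) w0.
    elim: (map _ _) => [|i [|j s] IH] // _.
      by exists i; rewrite /= ?inE ?leqnn.
    have [//|k ks sk] := IH.
    have [ik|ki] := leqP i k.
      by exists k; [rewrite inE ks orbT | apply/andP].
    exists i; first exact: mem_head.
    apply/andP; split=> //; apply: sub_all sk => t /= tk.
    exact: leq_trans tk (ltnW ki).
  have := parent_walk_parity ww wk.
  rewrite end_w addbb count_uniq_mem ?kw //.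
  by rewrite map_inj_uniq // => e e'; exact: ord_inj.
(* Connectedness goes through the vertex 0, reached by passing repeatedly to the parent. *)
have to_root n x : vval x = n ->
    exists2 w, walk x w & walk_end x w = (ord0 : 'I_m.+1).
  elim/ltn_ind: n x => -[|n] IH x xn.
    by exists [::] => //; apply: vval_inj.
  have nm : n < m by rewrite -ltnS -xn; exact: ltn_ord x.
  pose e : 'I_m := Ordinal nm.
  have pn : p n < m.+1 by rewrite ltnS (leq_trans (ple nm)) // ltnW.
  have vp : vval (inord (p n)) = p n by rewrite /vval inordK.
  have [|w ww end_w] := IH _ _ _ vp; first by rewrite ltnS ple.
  exists ((e : gedge G, inord (p n) : gvertex G) :: w) => //; split=> //.
  by rewrite /=; congr [set _; _]; apply: vval_inj; rewrite xn.
split; first by exists (ord0 : 'I_m.+1).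
move=> x y; have [wx wwx ex] := to_root _ x erefl.
have [wy /walk_rev] := to_root _ y erefl => /[swap] -> [w ww ew].
exists (wx ++ w); first by apply/walk_cat; rewrite ex.
by rewrite walk_end_cat ex.
Qed.

End ParentGraph.

(** The bound on parents needs care only at the last edge [i = n - 2] of types D and E, whose parent
    is [n - 3], respectively 2 with [n] at least 6. *)
Lemma dynkin_tree (G : graph) : is_dynkin G -> is_tree G.
Proof.
case=> [[n _]|[n n4]|[n n678]] /graph_iso_tree; apply; apply: parent_graph_tree.
- by [].
- by move=> i _; case: eqP => // <-; rewrite !subSS leq_subr.
- move=> i _; case: eqP => // ni; rewrite -ni in n678.
  by case: i n678 {ni} => [|[|i]].
Qed.

Theorem corollary1p5 (Q : quiver) :
  (is_tree (underlying_graph Q) ->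
     lattice_distributive (congruence (path_semigroup Q))) /\
  (is_dynkin (underlying_graph Q) ->
     is_tree (underlying_graph Q) /\
     lattice_distributive (congruence (path_semigroup Q))).
Proof.
have tree_dist : is_tree (underlying_graph Q) ->
    lattice_distributive (congruence (path_semigroup Q)).
  by move=> [_ acyclic]; exact: tree_congruence_distributive.
by split=> // /dynkin_tree treeQ; split; last exact: tree_dist.
Qed.
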